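(* Consider the DEI-NCG with cost parameter $\alpha>0$ on a set $V$ of $n$ agents partitioned into $k\ge2$ types, and let $n_R$ denote the largest size of a type. Then the following hold. (1) If $\alpha<\frac12$, then the complete network $K_n$ on $V$ is the unique pairwise stable network. (2) If $\alpha<1$, then every pairwise stable network is fully intra-connected. (3) If $\alpha<1$, then every pairwise stable network $G$ satisfies $\mathrm{diam}(G)\le2$. (4) The network $K_n$ is pairwise stable if $\alpha\le\frac{n-n_R}{n-n_R+1}$. (5) If $\alpha\ge1$, then the star $S_n$ and (for $k=2$) the double star $DS_n$ are pairwise stable networks. (6) If $\alpha\ge\frac43$, then (for $k=2$) the double star with switched centers $DSX_n$ is a pairwise stable network.
   Context: A network is an undirected graph $G=(V,E)$ on the set $V$ of $n$ agents; $V$ is partitioned into $k\ge2$ disjoint types. For $u\in V$: $\deg_G(u)$ is its degree, $e_G(u)$ is the number of neighbors of $u$ whose type differs from that of $u$, $d_G(u,v)$ is the length of a shortest path from $u$ to $v$ in $G$, and $d_G(u)=\sum_{v\in V}d_G(u,v)$. The diameter is $\mathrm{diam}(G)=\max_{u,v\in V}d_G(u,v)$. In the DEI-NCG (network creation game with decreasing effort of integration) with parameter $\alpha>0$, the cost of agent $u$ in $G$ is $$c_G(u)=\alpha\Big(\deg_G(u)+\sum_{i=1}^{e_G(u)}\frac1i\Big)+d_G(u).$$ A network $G=(V,E)$ is pairwise stable if (i) for every agent $u$ and every neighbor $v$ of $u$, $c_G(u)\le c_{G-uv}(u)$; and (ii) for every agent $u$ and every non-neighbor $v\ne u$ of $u$,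 $c_G(u)\le c_{G+uv}(u)$ or $c_G(v)\le c_{G+uv}(v)$. Here $G-uv$ and $G+uv$ denote $G$ with the edge $uv$ deleted or added, respectively. $G$ is fully intra-connected if any two distinct agents of the same type are adjacent. A star $S_n$ on $V$ has edge set $\{uv: v\in V\setminus\{u\}\}$ for some $u\in V$. For $k=2$ with types $V_B,V_R$ and given agents $u\in V_B$, $v\in V_R$: the double star $DS_n$ has edge set $\{uv\}\cup\{uw: w\in V_B\setminus\{u\}\}\cup\{vw: w\in V_R\setminus\{v\}\}$, and the double star with switched centers $DSX_n$ has edge set $\{uv\}\cup\{uw: w\in V_R\}\cup\{vw: w\in V_B\}$.
   Formalization: Pairwise stable networks are required to be connected (unreachable agents are at infinite distance); otherwise the edgeless network on three agents, types of sizes 2 and 1, would be pairwise stable and refute (1)–(3). *)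

(* Defs.v *)
From HB Require Import structures.
(* classical_sets must come first: it also defines partition and pblock, on
   classical sets, and would shadow those of finset. *)
From mathcomp Require Import classical_sets reals ereal.
From mathcomp Require Import all_boot all_order all_algebra.

Set Implicit Arguments.
Unset Strict Implicit.
Unset Printing Implicit Defensive.

Import Order.TTheory GRing.Theory Num.Theory.
Local Open Scope ring_scope.

(* A graph on V is given by its edge set E; it is a simple undirected graph
   when every edge is a two-element set. Types are the blocks of a partition P
   of V. *)
Section Graphs.
Variable V : finType.
Implicit Types (E P : {set {set V}}) (u v w : V).

Definition adj E : rel V := fun u v => [set u; v] \in E.

Definition simple_graph E : bool := [forall e in E, #|e| == 2%N].

Definition connected_graph E : bool := [forall u, forall v, connect (adj E) u v].

Definition neighbors E u : {set V} := [set v | adj E u v].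

Definition deg E u : nat := #|neighbors E u|.

Definition same_type P u v : bool := pblock P u == pblock P v.

Definition inter_deg P E u : nat :=
  #|[set v in neighbors E u | ~~ same_type P u v]|.

Definition add_edge E u v : {set {set V}} := [set u; v] |: E.

Definition del_edge E u v : {set {set V}} := E :\ [set u; v].

(* p lists the vertices after u on a path from u to v, so its length is size p. *)
Definition is_path E u v (p : seq V) : bool :=
  [&& path (adj E) u p, uniq (u :: p) & last u p == v].

Definition largest_type P : nat := (\max_(B in P) #|B|)%N.

Definition fully_intra_connected P E : Prop :=
  forall u v, u != v -> same_type P u v -> adj E u v.

Definition complete_network : {set {set V}} := [set e : {set V} | #|e| == 2%N].

Definition star u : {set {set V}} := [set [set u; v] | v in [set~ u]].

Definition double_star (VB VR : {set V}) u v : {set {set V}} :=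
  [set u; v] |: ([set [set u; w] | w in VB :\ u]
                 :|: [set [set v; w] | w in VR :\ v]).

Definition double_star_switched (VB VR : {set V}) u v : {set {set V}} :=
  [set u; v] |: ([set [set u; w] | w in VR] :|: [set [set v; w] | w in VB]).

End Graphs.

Section Game.
Variables (R : realType) (V : finType).
Implicit Types (E P : {set {set V}}) (u v : V) (alpha : R).

(* The infimum is +oo when v is not reachable from u. *)
Definition dist E u v : \bar R :=
  ereal_inf [set ((size p)%:R)%:E | p in [set p | is_path E u v p]]%classic.

Definition total_dist E u : \bar R := (\sum_(v : V) dist E u v)%E.

Definition diameter E : \bar R :=
  \big[Order.max/0%E]_(u : V) \big[Order.max/0%E]_(v : V) dist E u v.

Definition cost alpha P E u : \bar R :=
  ((alpha * ((deg E u)%:R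
             + \sum_(1 <= i < (inter_deg P E u).+1) (i%:R)^-1))%:E
   + total_dist E u)%E.

(* A network is a connected simple graph; a deviation E - uv may disconnect it
   and then has infinite cost. Connectivity cannot be dropped: the edgeless
   graph on three or more agents would be stable, since after adding any one
   edge all costs are still +oo. *)
Definition pairwise_stable alpha P E : Prop :=
  [/\ simple_graph E, connected_graph E,
      (forall u v, adj E u v ->
         (cost alpha P E u <= cost alpha P (del_edge E u v) u)%E)
    & (forall u v, v != u -> ~~ adj E u v ->
         (cost alpha P E u <= cost alpha P (add_edge E u v) u)%E \/
         (cost alpha P E v <= cost alpha P (add_edge E u v) v)%E)].

End Game.

(* Main.v *)
(* Adding a missing edge uv costs u exactly
   alpha (1 + [types differ] / (e(u) + 1)), between alpha and 2 alpha, and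
   lowers d(u) by at least d(u,v) - 1. This rules out missing edges when alpha
   is small and, read backwards, shows that no edge of K_n is worth deleting.
   Stars and double stars are trees, so deleting an edge costs +oo. Of two
   nonadjacent vertices u, v one, say v, is a leaf, and adding uv lowers d(u)
   by exactly d(u,v) - 1, which is 1, or 2 for leaves of different centers. *)
Require Import Defs.
From HB Require Import structures.
From mathcomp Require Import classical_sets reals ereal.
From mathcomp Require Import all_boot all_order all_algebra.
From mathcomp Require Import ring lra.

Set Implicit Arguments.
Unset Strict Implicit.
Unset Printing Implicit Defensive.

Import Order.TTheory GRing.Theory Num.Theory.
Local Open Scope ring_scope.

(** * Adjacency and degrees under a change of one edge *)

Section Adjacency.
Variable V : finType.
Implicit Types (E P : {set {set V}}) (u v w x y : V).

Lemma set2_eqE u v x y :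
  ([set x; y] == [set u; v]) =
  ((x == u) && (y == v)) || ((x == v) && (y == u)).
Proof.
apply/idP/idP => [/eqP e|]; last first.
  by case/orP => /andP[/eqP-> /eqP->] //; rewrite setUC.
have : x \in [set u; v] by rewrite -e set21.
have : y \in [set u; v] by rewrite -e set22.
have : u \in [set x; y] by rewrite e set21.
have : v \in [set x; y] by rewrite e set22.
rewrite !inE ![u == _]eq_sym ![v == _]eq_sym.
by case: (x == u); case: (x == v); case: (y == u); case: (y == v).
Qed.

Lemma adj_sym E : symmetric (adj E).
Proof. by move=> x y; rewrite /adj setUC. Qed.

Lemma adj_connect_sym E : connect_sym (adj E).
Proof. exact/sym_connect_sym/adj_sym. Qed.

Lemma adj_add_edge E u v x y : adj (add_edge E u v) x y =
  [|| (x == u) && (y == v), (x == v) && (y == u) | adj E x y].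
Proof. by rewrite /adj in_setU1 set2_eqE orbA. Qed.

Lemma adj_del_edge E u v x y : adj (del_edge E u v) x y =
  ~~ (((x == u) && (y == v)) || ((x == v) && (y == u))) && adj E x y.
Proof. by rewrite /adj in_setD1 set2_eqE. Qed.

Lemma add_edgeC E u v : add_edge E u v = add_edge E v u.
Proof. by rewrite /add_edge [[set u; v]]setUC. Qed.

Lemma del_edgeC E u v : del_edge E u v = del_edge E v u.
Proof. by rewrite /del_edge [[set u; v]]setUC. Qed.

Lemma add_del_edge E u v : adj E u v -> add_edge (del_edge E u v) u v = E.
Proof. exact: setD1K. Qed.

Lemma neighbors_add_edge E u v :
  v != u -> neighbors (add_edge E u v) u = v |: neighbors E u.
Proof.
move=> vu; apply/setP => w; rewrite !inE adj_add_edge eqxx /=.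
by rewrite [u == v]eq_sym (negPf vu).
Qed.

Lemma deg_add_edge E u v : v != u -> ~~ adj E u v ->
  deg (add_edge E u v) u = (deg E u).+1.
Proof.
by move=> vu uv; rewrite /deg neighbors_add_edge // cardsU1 inE uv.
Qed.

Lemma inter_deg_add_edge P E u v : v != u -> ~~ adj E u v ->
  inter_deg P (add_edge E u v) u = (~~ same_type P u v + inter_deg P E u)%N.
Proof.
move=> vu uv; rewrite /inter_deg neighbors_add_edge //.
rewrite (cardsD1 v) !inE eqxx /=; congr (_ + _)%N; apply: eq_card => w.
by rewrite !inE; case: eqP => // ->; rewrite (negPf uv).
Qed.

End Adjacency.

(** * Distances, and how a new edge changes them *)

Section Distance.
Variables (R : realType) (V : finType).
Implicit Types (E P : {set {set V}}) (u v w x y : V) (r : \bar R).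

Lemma dist_geP E u v r :
  (forall p, is_path E u v p -> (r <= (size p)%:R%:E)%E) -> (r <= dist R E u v)%E.
Proof. by move=> rp; apply/ereal_infP => _ [p /= /rp h <-]. Qed.

(** Shortcutting a walk leaves a simple path whose vertices all occur in the walk. Distances can
    thus be bounded by walks, with no check of simplicity. *)
Lemma dist_le_walk E u p :
  path (adj E) u p -> (dist R E u (last u p) <= (size p)%:R%:E)%E.
Proof.
case/shortenP => q qE uq sqp; apply: (@le_trans _ _ (size q)%:R%:E).
  apply: ge_ereal_inf; exists (size q)%:R%:E => //.
  by exists q => //=; rewrite /is_path qE uq /=.
by rewrite lee_fin ler_nat uniq_leq_size //; case/andP: uq.
Qed.

Lemma dist_ge0 E u v : (0 <= dist R E u v)%E.
Proof. by apply: dist_geP => p _; rewrite lee_fin. Qed.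

Lemma dist_ge2 E u v : v != u -> ~~ adj E u v -> (2%:R%:E <= dist R E u v)%E.
Proof.
move=> vu uv; apply: dist_geP => -[|x [|y p]] /and3P[pE _ /eqP/= e].
- by rewrite e eqxx in vu.
- by move: pE uv; rewrite /= e andbT => ->.
- by rewrite lee_fin ler_nat.
Qed.

Lemma dist_unreachable E u v : ~~ connect (adj E) u v -> dist R E u v = +oo%E.
Proof.
move=> uv; apply/eqP; rewrite -leye_eq; apply: dist_geP => p /and3P[pE _ /eqP e].
by case/connectP: uv; exists p.
Qed.

Lemma dist_fin_num E u v : connected_graph E -> dist R E u v \is a fin_num.
Proof.
move=> /forallP/(_ u)/forallP/(_ v)/connectP[p pE ->].
rewrite ge0_fin_numE ?dist_ge0 //.
exact: le_lt_trans (dist_le_walk pE) (ltry _).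
Qed.

Lemma total_dist_fin_num E u : connected_graph E -> total_dist R E u \is a fin_num.
Proof. by move=> cE; apply/sum_fin_numP => w _ _; exact: dist_fin_num. Qed.

Lemma total_dist_unreachable E u v :
  ~~ connect (adj E) u v -> total_dist R E u = +oo%E.
Proof.
move=> uv; apply/esum_eqyP.
  by move=> w _; rewrite gt_eqF // (lt_le_trans ltNy0) ?dist_ge0.
by exists v; rewrite dist_unreachable ?mem_index_enum.
Qed.

Lemma dist_add_edge_le E u v x y :
  (dist R (add_edge E u v) x y <= dist R E x y)%E.
Proof.
apply: dist_geP => p /and3P[pE _ /eqP <-]; apply: dist_le_walk.
by apply: sub_path pE => a b ab; rewrite adj_add_edge ab !orbT.
Qed.

Lemma dist_add_edge_ends E u v : (dist R (add_edge E u v) u v <= 1%:E)%E.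
Proof.
by apply: (@dist_le_walk _ u [:: v]); rewrite /= adj_add_edge !eqxx.
Qed.

(** Spreads the constant [m] over the vertices as a mass at [v], so that two total distances
    differing by [m] can be compared vertex by vertex. *)
Lemma sume_delta v (m : nat) : (\sum_w ((w == v)%:R * m%:R)%:E = (m%:R%:E : \bar R))%E.
Proof.
rewrite (bigD1 v) //= big1 ?eqxx ?mul1r ?adde0 // => w /negPf->.
by rewrite mul0r.
Qed.

Lemma total_dist_add_edge_le E u v (m : nat) : (m.+1%:R%:E <= dist R E u v)%E ->
  (total_dist R (add_edge E u v) u + m%:R%:E <= total_dist R E u)%E.
Proof.
move=> duv; rewrite -(sume_delta v m) -big_split /=; apply: lee_sum => w _.
case: eqP => [->|_]; last by rewrite mul0r adde0 dist_add_edge_le.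
apply: le_trans duv; rewrite mul1r -add1n natrD EFinD.
exact: leeD (dist_add_edge_ends _ _ _) _.
Qed.

(* A simple path from u in E + uv uses the new edge at most as its first step;
   such a path can then be rerouted inside E, through a walk of length at most
   two to its third vertex. *)
Lemma total_dist_add_edge_ge E u v (m : nat) : v != u ->
  (dist R E u v <= m.+1%:R%:E)%E ->
  (forall z, adj E v z ->
     exists q, [/\ path (adj E) u q, last u q = z & (size q <= 2)%N]) ->
  (total_dist R E u <= total_dist R (add_edge E u v) u + m%:R%:E)%E.
Proof.
move=> vu duv hz; rewrite -(sume_delta v m) -big_split /=; apply: lee_sum => w _.
(* The new edge has [u] as an end, so a path avoiding [u] already lies in [E]. *)
have pathE x p : u != x -> u \notin p -> path (adj (add_edge E u v)) x p ->
    path (adj E) x p.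
  elim: p x => //= y p IH x ux; rewrite inE negb_or => /andP[uy up] /andP[].
  move=> xy /(IH _ uy up) ->; move: xy; rewrite adj_add_edge andbT.
  case/or3P => [/andP[/eqP e _]|/andP[_ /eqP e]|//].
    by rewrite e eqxx in ux.
  by rewrite e eqxx in uy.
rewrite -leeBlDr //; apply: dist_geP => -[|x p] /and3P[].
  move=> _ _ /eqP/= <-; rewrite eq_sym (negPf vu) mul0r oppr0 adde0.
  exact: (@dist_le_walk E u [::]).
rewrite leeBlDr //= inE negb_or => /andP[ux pE] /andP[/andP[u_x up] _] /eqP lw.
move: pE => /(pathE _ _ u_x up) pE.
case: (eqVneq x v) ux => [xv _|xv]; last first.
  rewrite adj_add_edge eqxx (negPf xv) [x == u]eq_sym (negPf u_x) !andbF /= => ux.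
  rewrite -lw (le_trans (@dist_le_walk E u (x :: p) _)) /= ?ux ?pE //.
  by rewrite leeDl // lee_fin mulr_ge0.
(* The mass [m] matters only if the path stops at [v], where it makes up for the gap between 1 and
   [m.+1]; on longer paths it is nonnegative and dropped. *)
subst x; case: p up lw pE => [_ <- _|z p up lw /= /andP[/hz[q [qE qz sq]] pE]].
  by rewrite /= eqxx mul1r -EFinD -natrD.
apply: (@le_trans _ _ (size (q ++ p))%:R%:E).
  have := @dist_le_walk E u (q ++ p); rewrite last_cat qz /= in lw *.
  by rewrite lw cat_path qE qz; apply.
rewrite lee_fin -natrM -natrD ler_nat size_cat /=.
by rewrite (leq_trans _ (leq_addr _ _)) // -[(size p).+2]/(2 + size p)%N leq_add2r.
Qed.

End Distance.

(** * The price of an edge against the distance it saves *)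

Section EdgeCost.
Variables (R : realType) (V : finType) (alpha : R) (P : {set {set V}}).
Implicit Types (E : {set {set V}}) (u v w x y : V).

(** Here [E] is the network before [uv] is added, so the next harmonic term is the inverse of
    [(inter_deg P E u).+1]. *)
Definition edge_cost E u v : R :=
  alpha * (1 + (~~ same_type P u v)%:R / (inter_deg P E u).+1%:R).

Lemma edge_cost_le E u v : 0 <= alpha ->
  edge_cost E u v <= alpha * (1 + (~~ same_type P u v)%:R).
Proof.
move=> a0; rewrite ler_wpM2l // lerD2l ler_piMr //.
by rewrite invf_le1 // ler1n.
Qed.

Lemma edge_cost_ge E u v : 0 <= alpha -> alpha <= edge_cost E u v.
Proof. by move=> a0; rewrite ler_peMr // lerDl divr_ge0. Qed.

(** Both costs share the finite summand [c], which can then be cancelled without subtracting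
    extended reals. *)
Lemma cost_add_edge E u v : v != u -> ~~ adj E u v ->
  exists c : R, cost alpha P E u = (c%:E + total_dist R E u)%E /\
    cost alpha P (add_edge E u v) u =
      (c%:E + ((edge_cost E u v)%:E + total_dist R (add_edge E u v) u))%E.
Proof.
move=> vu uv; eexists; split; first by [].
rewrite /cost deg_add_edge // inter_deg_add_edge // addeA -EFinD -mulrDr.
congr ((alpha * _)%:E + _)%E; case: same_type => /=.
  by rewrite mul0r addr0 -natr1; ring.
by rewrite [X in _ + X = _]big_nat_recr //= mul1r -natr1; ring.
Qed.

Lemma cost_add_edge_le E u v (m : nat) : v != u -> ~~ adj E u v ->
  (m.+1%:R%:E <= dist R E u v)%E -> edge_cost E u v <= m%:R ->
  (cost alpha P (add_edge E u v) u <= cost alpha P E u)%E.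
Proof.
move=> vu uv /total_dist_add_edge_le dE em.
have [c [-> ->]] := cost_add_edge vu uv.
apply: leeD2l; apply: le_trans dE; rewrite addeC.
by apply: leeD2l; rewrite lee_fin.
Qed.

Lemma cost_add_edge_lt E u v (m : nat) : connected_graph E ->
  v != u -> ~~ adj E u v ->
  (m.+1%:R%:E <= dist R E u v)%E -> edge_cost E u v < m%:R ->
  (cost alpha P (add_edge E u v) u < cost alpha P E u)%E.
Proof.
move=> cE vu uv /total_dist_add_edge_le dE em.
have [c [-> ->]] := cost_add_edge vu uv.
rewrite lteD2lE //; apply: lt_le_trans dE; rewrite addeC lteD2lE ?lte_fin //.
(* Strictness survives adding the total distance only if that is finite, hence the connectedness of
   [E + uv]. *)
apply: total_dist_fin_num; apply/forallP => x; apply/forallP => y.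
move/forallP/(_ x)/forallP/(_ y): cE; apply: connect_sub => a b ab.
by apply: connect1; rewrite adj_add_edge ab !orbT.
Qed.

Lemma cost_add_edge_ge E u v (m : nat) : v != u -> ~~ adj E u v ->
  (dist R E u v <= m.+1%:R%:E)%E ->
  (forall z, adj E v z ->
     exists q, [/\ path (adj E) u q, last u q = z & (size q <= 2)%N]) ->
  m%:R <= edge_cost E u v ->
  (cost alpha P E u <= cost alpha P (add_edge E u v) u)%E.
Proof.
move=> vu uv duv hz me.
have [c [-> ->]] := cost_add_edge vu uv.
apply: leeD2l; apply: le_trans (total_dist_add_edge_ge vu duv hz) _.
by rewrite addeC; apply: leeD2r; rewrite lee_fin.
Qed.

(** The bound of [edge_cost_le] is symmetric in [u] and [v]. Were it below [m], both ends would
    strictly gain from the edge. *)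
Lemma stable_edge_cost E u v (m : nat) : pairwise_stable alpha P E ->
  0 <= alpha -> v != u -> ~~ adj E u v -> (m.+1%:R%:E <= dist R E u v)%E ->
  m%:R <= alpha * (1 + (~~ same_type P u v)%:R).
Proof.
move=> [_ cE _ sE] a0 vu uv duv; rewrite leNgt; apply/negP => lt.
have dvu : (m.+1%:R%:E <= dist R E v u)%E.
  apply: (le_trans duv); apply: dist_geP => p /and3P[pE _ /eqP/= lp].
  (* Distance is symmetric: this is the path from [v] to [u] reversed, with its new start [u]
     removed. *)
  have := @dist_le_walk R _ E u (rev (belast v p)).
  have -> : last u (rev (belast v p)) = v.
    by case: p {pE} lp => [|x p] //=; rewrite rev_cons last_rcons.
  rewrite size_rev size_belast; apply.
  by rewrite -{1}lp rev_path (eq_path (e' := adj E)) // => x y; rewrite /= adj_sym.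
case: (sE _ _ vu uv); rewrite leNgt => /negP[].
  exact: cost_add_edge_lt (le_lt_trans (edge_cost_le _ _ _ a0) lt).
rewrite add_edgeC; apply: cost_add_edge_lt dvu _ => //; rewrite 1?eq_sym 1?adj_sym //.
by apply: le_lt_trans (edge_cost_le _ _ _ a0) _; rewrite /same_type eq_sym.
Qed.

Lemma stable_dist_le E u v (m : nat) : pairwise_stable alpha P E ->
  0 <= alpha -> v != u -> ~~ adj E u v -> (m.+1%:R%:E <= dist R E u v)%E ->
  m%:R <= alpha * 2.
Proof.
move=> sE a0 vu uv duv; apply: le_trans (stable_edge_cost sE a0 vu uv duv) _.
by rewrite ler_wpM2l // -[leRHS]/(1 + 1) lerD2l lern1 leq_b1.
Qed.

Lemma cost_disconnected E u v :
  ~~ connect (adj E) u v -> cost alpha P E u = +oo%E.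
Proof. by move=> uv; rewrite /cost (total_dist_unreachable R uv) addey. Qed.

Lemma adj_complete u v : adj (complete_network V) u v = (v != u).
Proof. by rewrite /adj inE cards2 [v == u]eq_sym; case: (u == v). Qed.

(** No edge can be added. Deletion is judged by viewing the network as the deleted one plus [uv],
    where [uv] saves at least 1. *)
Lemma complete_stable :
  (forall u v, v != u -> edge_cost (del_edge (complete_network V) u v) u v <= 1) ->
  pairwise_stable alpha P (complete_network V).
Proof.
move=> hK; split.
- by apply/forall_inP => e; rewrite inE.
- apply/forallP => u; apply/forallP => v; have [->|vu] := eqVneq v u.
    exact: connect0.
  by apply: connect1; rewrite adj_complete.
- move=> u v uv; rewrite -{1}(add_del_edge uv).
  move: uv; rewrite adj_complete => vu.
  have nuv : ~~ adj (del_edge (complete_network V) u v) u v.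
    by rewrite adj_del_edge !eqxx.
  by apply: (@cost_add_edge_le _ _ _ 1) => //; [exact: dist_ge2 | exact: hK].
- by move=> u v vu; rewrite adj_complete vu.
Qed.

End EdgeCost.

(** * Stability of trees with two adjacent centers *)

Section DoubleStars.
Variables (V : finType) (a b : V) (c : V -> V).
Hypotheses (ab : a != b) (ca : c a = b) (cb : c b = a).
Hypothesis c_ab : forall x, c x = a \/ c x = b.
Implicit Types (u v w x y z : V).

(* Stars, double stars and double stars with switched centers all have this
   form: c sends each center to the other one and each leaf to its center. *)
Definition attach_graph : {set {set V}} := [set [set x; c x] | x : V].
Local Notation E := attach_graph.

Lemma adj_attach x y : adj E x y = (c x == y) || (c y == x).
Proof.
apply/imsetP/idP => [[z _ /eqP]|/orP[/eqP<-|/eqP<-]].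
- by rewrite set2_eqE => /orP[]/andP[/eqP-> /eqP->]; rewrite eqxx ?orbT.
- by exists x.
- by exists y; rewrite // setUC.
Qed.

Lemma attach_neq x : c x != x.
Proof.
by apply/eqP => e; case: (c_ab x) => h; move: h (h); rewrite {1}e => ->;
  rewrite ?ca ?cb => e'; move: ab; rewrite e' eqxx.
Qed.

Lemma attachK x : c (c (c x)) = c x.
Proof. by case: (c_ab x) => ->; rewrite ?(ca, cb). Qed.

Lemma attach_eq x y : c x = c y \/ c x = c (c y).
Proof. by case: (c_ab x) => ->; case: (c_ab y) => ->; rewrite ?ca ?cb; auto. Qed.

(** The target [c y] is a center: either the one next to [x], or one step further across the central
    edge. *)
Lemma attach_walk2 x y :
  exists q, [/\ path (adj E) x q, last x q = c y & (size q <= 2)%N].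
Proof.
have [e|e] := attach_eq y x.
  by exists [:: c x]; rewrite /= adj_attach eqxx e.
by exists [:: c x; c (c x)]; rewrite /= !adj_attach !eqxx e.
Qed.

Lemma attach_walk3 x y :
  exists q, [/\ path (adj E) x q, last x q = y & (size q <= 3)%N].
Proof.
have [q [qE lq sq]] := attach_walk2 x y; exists (rcons q y).
by rewrite rcons_path last_rcons size_rcons lq qE adj_attach eqxx orbT.
Qed.

Lemma attach_simple : simple_graph E.
Proof.
by apply/forall_inP => _ /imsetP[x _ ->]; rewrite cards2 [x == _]eq_sym attach_neq.
Qed.

Lemma attach_connected : connected_graph E.
Proof.
apply/forallP => x; apply/forallP => y.
by have [q [qE lq _]] := attach_walk3 x y; apply/connectP; exists q.
Qed.

(* The set S is the component of x once the edge x - c x is deleted. *)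
Lemma attach_cut x : ~~ connect (adj (del_edge E x (c x))) x (c x).
Proof.
pose S := [pred z | (z == x) || (z != c x) && (c z == x)].
have S_closed : closed (adj (del_edge E x (c x))) S.
  apply: intro_closed => [|z t]; first exact: adj_connect_sym.
  rewrite adj_del_edge adj_attach !inE => /andP[nxz adj_zt].
  have [zx _|zx /= /andP[zcx /eqP cz]] := eqVneq z x.
    move: nxz adj_zt; rewrite zx eqxx /= negb_or ![_ == t]eq_sym.
    by case/andP => /negPf-> _ /= ->; rewrite orbT.
  case/orP: adj_zt => /eqP e; first by rewrite -e cz eqxx.
  (* A vertex [z = c t] with [c z = x] is a center, so it would equal [c (c z) = c x], which is
     excluded. *)
  by move: zcx; rewrite -cz -e attachK eqxx.
apply/negP => /(closed_connect S_closed).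
by rewrite /S !inE !eqxx (negPf (attach_neq x)).
Qed.

(** All values of [c] are centers, so the only neighbor of a leaf [x] is [c x]. *)
Lemma attach_leaf_inter_deg (P : {set {set V}}) x : x != a -> x != b ->
  inter_deg P E x = ~~ same_type P x (c x).
Proof.
move=> xa xb; have nE w : adj E x w = (w == c x).
  rewrite adj_attach [c x == w]eq_sym.
  by case: (c_ab w) => ->; rewrite ![_ == x]eq_sym ?(negPf xa, negPf xb) orbF.
case sxc: (same_type P x (c x)); rewrite /inter_deg /=.
  apply/eqP; rewrite cards_eq0; apply/eqP/setP => w; rewrite !inE nE.
  by case: eqP => // ->; rewrite sxc.
rewrite -(cards1 (c x)); apply: eq_card => w; rewrite !inE nE.
by case: eqP => // ->; rewrite sxc.
Qed.

(** Joining leaves of different centers saves 2, which the last hypothesis weighs against the price.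
    Every other new edge to a leaf saves 1, at a price of at least [alpha]. *)
Lemma attach_stable (R : realType) (alpha : R) (P : {set {set V}}) :
  1 <= alpha ->
  (forall x y, x != a -> x != b -> y != a -> y != b -> c x != c y ->
     2 <= alpha * (1 + (~~ same_type P x y)%:R
                         / (~~ same_type P x (c x)).+1%:R)) ->
  pairwise_stable alpha P E.
Proof.
move=> a1 a2; have a0 : 0 <= alpha by lra.
split; [exact: attach_simple | exact: attach_connected | |].
  move=> x y; rewrite adj_attach => /orP[]/eqP<-.
    by rewrite (cost_disconnected alpha P (attach_cut x)) leey.
  have cut : ~~ connect (adj (del_edge E y (c y))) (c y) y.
    by rewrite adj_connect_sym attach_cut.
  by rewrite del_edgeC (cost_disconnected alpha P cut) leey.
(* One unwilling end suffices: a new edge to a leaf [y] never pays off for [x]. *)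
have key x y : y != x -> ~~ adj E x y -> y != a -> y != b ->
    (cost alpha P E x <= cost alpha P (add_edge E x y) x)%E.
  move=> yx xy ya yb.
  have hz z : adj E y z ->
      exists q, [/\ path (adj E) x q, last x q = z & (size q <= 2)%N].
    rewrite adj_attach => /orP[/eqP<-|/eqP e]; first exact: attach_walk2.
    by case: (c_ab z) => h; move: ya yb; rewrite -e h eqxx.
  have [e|ne] := eqVneq (c x) (c y).
    apply: (@cost_add_edge_ge _ _ _ _ _ _ _ 1) => //; last first.
      exact: le_trans (edge_cost_ge _ _ _ _ a0).
    by apply: (@dist_le_walk R _ E x [:: c x; y]); rewrite /= !adj_attach e !eqxx orbT.
  apply: (@cost_add_edge_ge _ _ _ _ _ _ _ 2) => //.
    have [q [qE <- sq]] := attach_walk3 x y.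
    by apply: le_trans (dist_le_walk R qE) _; rewrite lee_fin ler_nat.
  (* A center [x] with [c x] different from [c y] would be [c y] itself, hence adjacent to [y]. *)
  have [xa xb] : x != a /\ x != b.
    move: xy; rewrite adj_attach negb_or => /andP[_ cyx].
    by split; apply/eqP => xe; move: ne cyx; rewrite xe;
      case: (c_ab y) => ->; rewrite ?ca ?cb ?eqxx.
  by rewrite /edge_cost attach_leaf_inter_deg //; exact: a2.
move=> x y yx xy.
have [ycen|] := boolP ((y == a) || (y == b)); last first.
  by rewrite negb_or => /andP[ya yb]; left; exact: key.
(* The two centers are adjacent, so if [y] is a center then [x] is a leaf and the roles are
   swapped. *)
have [xa xb] : x != a /\ x != b.
  move: yx xy; rewrite adj_attach negb_or => yx /andP[cxy _].
  by split; apply/eqP => e; case/orP: ycen yx cxy => /eqP->; rewrite e ?ca ?cb ?eqxx.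
right; rewrite add_edgeC; apply: key => //; first by rewrite eq_sym.
by rewrite adj_sym.
Qed.

End DoubleStars.

(** * Counting in the partition into types *)

Section Types.
Variables (V : finType) (P : {set {set V}}).
Hypothesis hP : partition P [set: V].
Hypothesis hP2 : (2 <= #|P|)%N.

(** A block equal to all of [V] would meet any second block, which exists and is nonempty. *)
Lemma block_card_lt B : B \in P -> (#|B| < #|V|)%N.
Proof.
case/and3P: hP => _ tP P0 BP; rewrite ltn_neqAle max_card andbT.
apply/eqP => BV; have BT : B = [set: V].
  by apply/eqP; rewrite eqEcard subsetT cardsT BV leqnn.
have : (0 < #|P :\ B|)%N by move: hP2; rewrite (cardsD1 B) BP.
case/card_gt0P => B'; rewrite in_setD1 => /andP[nBB' B'P].
have /set0Pn[x xB'] : B' != set0 by apply: contraNneq P0 => <-.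
case/eqP: nBB'; rewrite -(def_pblock tP B'P xB').
by apply: def_pblock; rewrite // BT inE.
Qed.

Lemma largest_type_lt : (largest_type P < #|V|)%N.
Proof.
have V0 : (0 < #|V|)%N.
  have /card_gt0P[B BP] : (0 < #|P|)%N by exact: ltnW.
  exact: leq_ltn_trans (block_card_lt BP).
(* The maximum is bounded blockwise by a non-strict inequality, so the bound is taken to be one less
   than [#|V|]. *)
rewrite -(prednK V0) ltnS; apply/bigmax_leqP => B /block_card_lt.
by rewrite -{1}(prednK V0) ltnS.
Qed.

Lemma pblock_in u : pblock P u \in P.
Proof. by case/and3P: hP => /eqP cP _ _; rewrite pblock_mem // cP inE. Qed.

(** Supplies the second center when a star is treated as a double star. *)
Lemma exists_other (u : V) : exists v, v != u.
Proof.
have /block_card_lt : pblock P u \in P by exact: pblock_in.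
rewrite -(cardsC (pblock P u)) -ltn_subLR // subnn => /card_gt0P.
case=> v; rewrite inE => vu; exists v; apply: contraNneq vu => ->.
by case/and3P: hP => /eqP cP _ _; rewrite mem_pblock cP inE.
Qed.

Lemma inter_deg_complete u :
  inter_deg P (complete_network V) u = (#|V| - #|pblock P u|)%N.
Proof.
case/and3P: hP => /eqP cP tP _; rewrite -(cardsC (pblock P u)) addKn.
apply: eq_card => w.
have uP w' : w' \in cover P by rewrite cP inE.
rewrite !inE adj_complete /same_type eq_pblock // andb_idl //.
by apply: contraNneq => ->; rewrite mem_pblock.
Qed.

(** Reduces comparisons of types to membership in [VB]. Having at least two blocks forces [VB] and
    [VR] to differ. *)
Lemma same_type_bipartition (VB VR : {set V}) : P = [set VB; VR] ->
  (forall x, (x \in VR) = (x \notin VB)) /\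
  forall x y, same_type P x y = ((x \in VB) == (y \in VB)).
Proof.
move=> PE; case/and3P: hP => /eqP cP tP _.
have pB x : x \in VB -> pblock P x = VB by apply: def_pblock; rewrite // PE set21.
have pR x : x \in VR -> pblock P x = VR by apply: def_pblock; rewrite // PE set22.
have BR : VB != VR by move: hP2; rewrite PE cards2; case: (VB != VR).
have RB x : (x \in VR) = (x \notin VB).
  apply/idP/idP => [xR|xB]; first by apply: contra BR => xB; rewrite -(pB _ xB) pR.
  have : x \in cover P by rewrite cP inE.
  by case/bigcupP => B; rewrite PE !inE => /orP[]/eqP-> //; rewrite (negPf xB).
split=> // x y; rewrite /same_type.
case: (boolP (x \in VB)) => xB; case: (boolP (y \in VB)) => yB;
  rewrite ?(pB _ xB) ?(pB _ yB) ?(pR x) ?(pR y) ?RB //.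
- exact: eqxx.
- exact: negPf.
- by rewrite eq_sym (negPf BR).
- exact: eqxx.
Qed.

End Types.

(** * The named trees as attachment graphs *)

Section NamedGraphs.
Variable V : finType.
Implicit Types (u v w : V).

(** An arbitrary leaf [v] serves as second center, with no leaves of its own; the edge [uv] then
    arises from both its ends. *)
Lemma star_attach u v : v != u ->
  star u = attach_graph (fun w => if w == u then v else u).
Proof.
move=> vu; apply/setP => e; apply/imsetP/imsetP => -[w wP ->].
  by move: wP; rewrite !inE => /negPf wu; exists w; rewrite // wu setUC.
case: eqP => [->|/eqP wu]; first by exists v; rewrite // !inE.
by exists w; rewrite ?inE // setUC.
Qed.

Lemma double_star_attach (VB VR : {set V}) u v :
  (forall x, (x \in VR) = (x \notin VB)) -> u \in VB -> v \in VR ->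
  double_star VB VR u v = attach_graph
    (fun w => if w == u then v else if w == v then u
              else if w \in VB then u else v).
Proof.
move=> RB uB vR; apply/setP => e; rewrite in_setU1 in_setU; apply/idP/imsetP.
  case/orP => [/eqP->|/orP[]/imsetP[w]].
  - by exists u; rewrite ?eqxx.
  - rewrite !inE => /andP[/negPf wu wB] ->; exists w => //.
    rewrite wu wB; case: eqP => [wv|_]; last by rewrite setUC.
    by move: wB vR; rewrite wv RB => ->.
  - rewrite !inE => /andP[/negPf wv wR] ->; exists w => //.
    rewrite wv; case: eqP => [wu|_]; last by rewrite -if_neg -RB wR setUC.
    by move: wR; rewrite RB wu uB.
case=> w _ ->; have [->|wu] := eqVneq w u; first by rewrite eqxx.
have [->|wv] := eqVneq w v; first by rewrite setUC eqxx.
apply/orP; right; apply/orP; case: ifPn => wB; [left|right]; apply/imsetP;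
  by exists w; rewrite 1?setUC // !inE ?wu ?wv ?RB.
Qed.

(** The centers need no separate case here: sending each vertex to the center of the other type
    already swaps [u] and [v]. *)
Lemma double_star_switched_attach (VB VR : {set V}) u v :
  (forall x, (x \in VR) = (x \notin VB)) -> u \in VB -> v \in VR ->
  double_star_switched VB VR u v =
  attach_graph (fun w => if w \in VB then v else u).
Proof.
move=> RB uB vR; apply/setP => e; rewrite in_setU1 in_setU; apply/idP/imsetP.
  case/orP => [/eqP->|/orP[]/imsetP[w wP ->]].
  - by exists u; rewrite ?uB.
  - by exists w; rewrite // -if_neg -RB wP setUC.
  - by exists w; rewrite // wP setUC.
case=> w _ ->; apply/orP; right; apply/orP.
by case: ifPn => wB; [right|left]; apply/imsetP; exists w; rewrite ?RB // setUC.
Qed.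

End NamedGraphs.

(** For ends of different types, the price is at most 1 exactly when [alpha] is at most
    [t / (t + 1)], with [t] the inter-type degree of [u] in the complete network. This fraction
    grows with [t], and [t] is smallest for the largest type. *)
Lemma edge_cost_complete_le (R : realType) (V : finType) (P : {set {set V}})
    (alpha : R) (u v : V) :
  partition P [set: V] -> (2 <= #|P|)%N -> 0 < alpha -> v != u ->
  alpha <= (#|V|%:R - (largest_type P)%:R)
             / (#|V|%:R - (largest_type P)%:R + 1) ->
  edge_cost alpha P (del_edge (complete_network V) u v) u v <= 1.
Proof.
move=> hP hP2 a0 vu; have lt := largest_type_lt hP hP2.
rewrite -natrB 1?ltnW //; set N := (#|V| - largest_type P)%N.
have N0 : (0 < N)%N by rewrite subn_gt0.
rewrite ler_pdivlMr ?ltr_wpDl // => aN.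
have aN' : alpha * N%:R <= N%:R - alpha by lra.
have N1 : 1 <= N%:R :> R by rewrite ler1n.
rewrite /edge_cost; case: (boolP (same_type P u v)) => [_|nuv] /=.
  rewrite mul0r addr0 mulr1; nra.
(* Here [d] is counted after deleting [uv], so [d.+1] is the degree [t] in the complete network. *)
set d := inter_deg _ _ _; have Nd : (N <= d.+1)%N.
  have -> : d.+1 = inter_deg P (complete_network V) u.
    have uv : adj (complete_network V) u v by rewrite adj_complete.
    rewrite -[in RHS](add_del_edge uv) inter_deg_add_edge ?nuv //.
    by rewrite adj_del_edge !eqxx.
  rewrite inter_deg_complete // leq_sub2l //.
  by apply: (leq_bigmax_cond (F := fun B : {set V} => #|B|)); exact: pblock_in.
have {}Nd : N%:R <= d.+1%:R :> R by rewrite ler_nat.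
have d0 : 0 < d.+1%:R :> R by rewrite ltr0n.
rewrite mul1r -(ler_pM2r d0) -mulrA mulrDl mulVf ?gt_eqF // !mul1r.
nra.
Qed.

(** * The six claims, from prices weighed against savings *)

Theorem proposition5p1 (R : realType) (V : finType) (n k nR : nat)
    (P : {set {set V}}) (alpha : R)
    (hn : #|V| = n) (hP : partition P [set: V]) (hk : #|P| = k)
    (hk2 : (2 <= k)%N) (hnR : nR = largest_type P) (halpha : 0 < alpha) :
  (alpha < 1 / 2 ->
     pairwise_stable alpha P (complete_network V) /\
     (forall E : {set {set V}},
        pairwise_stable alpha P E -> E = complete_network V)) /\
  (alpha < 1 ->
     forall E : {set {set V}},
       pairwise_stable alpha P E -> fully_intra_connected P E) /\
  (alpha < 1 ->
     forall E : {set {set V}},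
       pairwise_stable alpha P E -> (diameter R E <= 2%:R%:E)%E) /\
  (alpha <= (n%:R - nR%:R) / (n%:R - nR%:R + 1) ->
     pairwise_stable alpha P (complete_network V)) /\
  (1 <= alpha ->
     (forall u : V, pairwise_stable alpha P (star u)) /\
     (k = 2%N ->
        forall (VB VR : {set V}) (u v : V),
          P = [set VB; VR] -> u \in VB -> v \in VR ->
          pairwise_stable alpha P (double_star VB VR u v))) /\
  (4 / 3 <= alpha ->
     k = 2%N ->
     forall (VB VR : {set V}) (u v : V),
       P = [set VB; VR] -> u \in VB -> v \in VR ->
       pairwise_stable alpha P (double_star_switched VB VR u v)).
Proof.
have a0 : 0 <= alpha := ltW halpha.
have hP2 : (2 <= #|P|)%N by rewrite hk.
have K_stable : alpha <= (n%:R - nR%:R) / (n%:R - nR%:R + 1) ->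
    pairwise_stable alpha P (complete_network V).
  rewrite -hn hnR => aN; apply: complete_stable => u v vu.
  exact: edge_cost_complete_le.
split=> [a_lt|].
  split=> [|E sE].
    (* Since [n - nR] is at least 1, the threshold of claim (4) is at least 1/2. *)
    apply: K_stable; have nRn : nR%:R + 1 <= n%:R :> R.
      by rewrite natr1 ler_nat -hn hnR largest_type_lt.
    by rewrite ler_pdivlMr; [nra|lra].
  have adjE u v : v != u -> adj E u v.
    move=> vu; apply: contraT => uv.
    (* A missing edge saves at least 1 but costs at most [2 * alpha], which is below 1. *)
    have := @stable_dist_le _ _ _ _ _ _ _ 1 sE a0 vu uv (dist_ge2 _ vu uv).
    by lra.
  apply/setP => e; rewrite inE; apply/idP/idP => [eE|/cards2P[u [v [uv ->]]]].
    by case: sE => /forall_inP/(_ _ eE).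
  by apply: adjE; rewrite eq_sym.
split=> [a_lt E sE u v uv tuv|].
  apply: contraT => nuv; have vu : v != u by rewrite eq_sym.
  have := @stable_edge_cost _ _ _ _ _ _ _ 1 sE a0 vu nuv (dist_ge2 _ vu nuv).
  by rewrite tuv addr0 mulr1 mulr1n leNgt a_lt.
split=> [a_lt E sE|].
  apply: bigmax_le => [|u _]; first by rewrite lee_fin.
  apply: bigmax_le => [|v _]; first by rewrite lee_fin.
  rewrite leNgt; apply/negP => d2.
  (* Path lengths are integers, so a distance above 2 is at least 3, and an edge would save 2 at a
     price below 2. *)
  have d3 : (3%:R%:E <= dist R E u v)%E.
    apply: dist_geP => p /and3P[pE _ /eqP/= lp].
    have := dist_le_walk R pE; rewrite lp => /(lt_le_trans d2).
    by rewrite lte_fin lee_fin ltr_nat ler_nat.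
  have vu : v != u.
    apply: contraTneq d2 => ->; rewrite -leNgt.
    by apply: le_trans (@dist_le_walk R _ E u [::] isT) _; rewrite lee_fin.
  have nuv : ~~ adj E u v.
    apply: contraTN d2 => uv; rewrite -leNgt.
    apply: le_trans (@dist_le_walk R _ E u [:: v] _) _; first by rewrite /= uv.
    by rewrite lee_fin ler_nat.
  have := @stable_dist_le _ _ _ _ _ _ _ 2 sE a0 vu nuv d3.
  by lra.
split=> //; split=> [a1|a43 _ VB VR u v PE uB vR].
  split=> [u|_ VB VR u v PE uB vR].
    have [v vu] := exists_other hP hP2 u.
    rewrite (star_attach vu); apply: (@attach_stable _ u v) => //.
    - by rewrite eq_sym.
    - by rewrite eqxx.
    - by rewrite (negPf vu).
    - by move=> w; case: ifP; auto.
    (* All leaves of a star share the center [u], so no pair of leaves needs the price bound. *)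
    - by move=> x y /negPf-> _ /negPf->; rewrite eqxx.
  have [RB tE] := same_type_bipartition hP hP2 PE.
  have vB : v \in VB = false by apply/negbTE; rewrite -RB.
  have vu : v != u by apply: contraTneq uB => <-; rewrite vB.
  rewrite double_star_attach //; apply: (@attach_stable _ u v) => //.
  - by rewrite eq_sym.
  - by rewrite eqxx.
  - by rewrite eqxx (negPf vu).
  - by move=> w; do !case: ifP; auto.
  (* A leaf has the type of its center, and leaves of different centers differ in type: the price is
     [2 * alpha]. *)
  - move=> x y /negPf xu /negPf xv /negPf yu /negPf yv; rewrite xu xv yu yv !tE.
    do 2 case: ifP; rewrite ?uB ?vB ?eqxx //= => _ _ _; lra.
have [RB tE] := same_type_bipartition hP hP2 PE.
have vB : v \in VB = false by apply/negbTE; rewrite -RB.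
have vu : v != u by apply: contraTneq uB => <-; rewrite vB.
rewrite double_star_switched_attach //; apply: (@attach_stable _ u v) => //.
- by rewrite eq_sym.
- by rewrite uB.
- by rewrite vB.
- by move=> w; case: ifP; auto.
- lra.
(* A leaf already has one neighbor of the other type, its center, so the price is
   [alpha * (1 + 1/2)]. It reaches 2 at [alpha = 4/3]. *)
- move=> x y _ _ _ _; rewrite !tE.
  do 2 case: ifP; rewrite ?uB ?vB ?eqxx //= => _ _ _; lra.
Qed.
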